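(* Let $\alpha,\beta,\gamma\in\mathbb{R}$ with $\gamma\neq 0$, and let $(G_2,g,J)$ be the connected, simply connected three-dimensional Lorentzian Lie group with product structure $J$ whose Lie algebra $\mathfrak{g}$ has a pseudo-orthonormal basis $\{e_1,e_2,e_3\}$ ($e_3$ timelike) with $[e_1,e_2]=\gamma e_2-\beta e_3$, $[e_1,e_3]=-\beta e_2-\gamma e_3$, $[e_2,e_3]=\alpha e_1$. Let $c\in\mathbb{R}$. Then $(G_2,g,J)$ is a first kind algebraic Ricci soliton associated to the Kobayashi-Nomizu connection $\nabla^1$ with constant $c$ if and only if $\alpha=\beta=0$, $\gamma^2+c=0$, $\gamma\neq 0$. In particular, in that case $\mathrm{Ric}^1(e_1)=-\gamma^2e_1$, $\mathrm{Ric}^1(e_2)=-\gamma^2e_2$, $\mathrm{Ric}^1(e_3)=0$, and $De_1=0$, $De_2=0$, $De_3=\gamma^2e_3$.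
   Context: The left-invariant Lorentzian metric $g$ satisfies $g(e_1,e_1)=g(e_2,e_2)=1$, $g(e_3,e_3)=-1$, $g(e_i,e_j)=0$ for $i\ne j$. All tensors and connections are left-invariant and evaluated on $\mathfrak{g}$. $\nabla$ is the Levi-Civita connection of $g$. The product structure is $Je_1=e_1$, $Je_2=e_2$, $Je_3=-e_3$, and $(\nabla_XJ)Y=\nabla_X(JY)-J(\nabla_XY)$. The canonical connection is $\nabla^0_XY=\nabla_XY-\frac12(\nabla_XJ)(JY)$ and the Kobayashi-Nomizu connection is $\nabla^1_XY=\nabla^0_XY-\frac14[(\nabla_YJ)(JX)-(\nabla_{JY}J)X]$, with curvature $R^1(X,Y)Z=\nabla^1_X\nabla^1_YZ-\nabla^1_Y\nabla^1_XZ-\nabla^1_{[X,Y]}Z$. Its Ricci tensor is $\rho^1(X,Y)=-g(R^1(X,e_1)Y,e_1)-g(R^1(X,e_2)Y,e_2)+g(R^1(X,e_3)Y,e_3)$ and the Ricci operator $\mathrm{Ric}^1$ is defined by $\rho^1(X,Y)=g(\mathrm{Ric}^1(X),Y)$. First kind algebraic Ricci soliton associated to $\nabla^1$ with constant $c$ means: $\mathrm{Ric}^1=c\,\mathrm{Id}+D$ where $D$ is a derivation of $\mathfrak{g}$, i.e. a linear map with $D[X,Y]=[DX,Y]+[X,DY]$ for all $X,Y\in\mathfrak{g}$. *)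

(* Defs.v *)
From HB Require Import structures.
From mathcomp Require Import all_boot all_order all_algebra.
From mathcomp Require Import reals ring lra.
Set Implicit Arguments.
Unset Strict Implicit.
Unset Printing Implicit Defensive.
Import Order.TTheory GRing.Theory Num.Theory.
Local Open Scope ring_scope.

(* A Lie group is represented by its Lie algebra, the space V of left-invariant
   vector fields; left-invariant tensors and connections are multilinear maps
   on V. *)

Definition lie_bracket (R : realType) (V : vectType R) (br : V -> V -> V) :=
  (forall X, br X X = 0) /\
  (forall X Y Z, br X (br Y Z) + br Y (br Z X) + br Z (br X Y) = 0).

Definition pseudo_orthonormal_basis (R : realType) (V : vectType R)
    (g : V -> V -> R) (e1 e2 e3 : V) :=
  [/\ basis_of fullv [:: e1; e2; e3],
      [/\ g e1 e1 = 1, g e2 e2 = 1 & g e3 e3 = -1],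
      [/\ g e1 e2 = 0, g e1 e3 = 0 & g e2 e3 = 0] &
      [/\ g e2 e1 = 0, g e3 e1 = 0 & g e3 e2 = 0]].

(* The metric condition Xg(Y,Z) = g(nabla_X Y,Z) + g(Y,nabla_X Z) has zero
   left-hand side here, since g(Y,Z) is constant for left-invariant Y and Z. *)
Definition levi_civita (R : realType) (V : vectType R) (br : V -> V -> V)
    (g : V -> V -> R) (nabla : V -> V -> V) :=
  (forall X Y, nabla X Y - nabla Y X = br X Y) /\
  (forall X Y Z, g (nabla X Y) Z + g Y (nabla X Z) = 0).

Definition covderiv_J (R : realType) (V : vectType R) (nabla : V -> V -> V)
    (J : V -> V) (X Y : V) : V :=
  nabla X (J Y) - J (nabla X Y).

Definition canonical_connection (R : realType) (V : vectType R)
    (nabla : V -> V -> V) (J : V -> V) (X Y : V) : V :=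
  nabla X Y - 2^-1 *: covderiv_J nabla J X (J Y).

Definition kobayashi_nomizu_connection (R : realType) (V : vectType R)
    (nabla : V -> V -> V) (J : V -> V) (X Y : V) : V :=
  canonical_connection nabla J X Y
  - 4^-1 *: (covderiv_J nabla J Y (J X) - covderiv_J nabla J (J Y) X).

Definition curvature (R : realType) (V : vectType R) (br : V -> V -> V)
    (nabla : V -> V -> V) (X Y Z : V) : V :=
  nabla X (nabla Y Z) - nabla Y (nabla X Z) - nabla (br X Y) Z.

Definition ricci_tensor (R : realType) (V : vectType R) (br : V -> V -> V)
    (g : V -> V -> R) (e1 e2 e3 : V) (nabla : V -> V -> V) (X Y : V) : R :=
  - g (curvature br nabla X e1 Y) e1 - g (curvature br nabla X e2 Y) e2
  + g (curvature br nabla X e3 Y) e3.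

(* The Ricci tensor of a connection with torsion need not be symmetric, so the
   order of the arguments matters. *)
Definition ricci_operator (R : realType) (V : vectType R)
    (rho g : V -> V -> R) (Ric : V -> V) :=
  forall X Y, rho X Y = g (Ric X) Y.

Definition derivation (R : realType) (V : vectType R) (br : V -> V -> V)
    (D : V -> V) :=
  forall X Y, D (br X Y) = br (D X) Y + br X (D Y).

Definition soliton_decomposition (R : realType) (V : vectType R)
    (br : V -> V -> V) (Ric : 'End(V)) (c : R) (D : 'End(V)) :=
  derivation br D /\ Ric = c *: \1%VF + D.

Definition algebraic_ricci_soliton (R : realType) (V : vectType R)
    (br : V -> V -> V) (Ric : 'End(V)) (c : R) :=
  exists D : 'End(V), soliton_decomposition br Ric c D.

(* The Levi-Civita connection and the Ricci operator exist and are unique, so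
   that quantifying over them under their characterizing properties is the
   same as defining them. *)

Lemma pseudo_orthonormal_expansion (R : realType) (V : vectType R)
    (g : {biscalar V}) (e1 e2 e3 : V) :
  pseudo_orthonormal_basis g e1 e2 e3 ->
  forall X, X = g X e1 *: e1 + g X e2 *: e2 - g X e3 *: e3.
Proof.
case=> be [g11 g22 g33] [g12 g13 g23] [g21 g31 g32] X.
have : X \in <<[tuple e1; e2; e3]>>%VS by rewrite (span_basis be) memvf.
move/coord_span; rewrite !big_ord_recr big_ord0 /= add0r.
move: (coord _ _ X) (coord _ _ X) (coord _ _ X) => a b d ->.
rewrite !linearDl !linearZl_LR /=.
rewrite g11 g22 g33 g12 g13 g23 g21 g31 g32 !mulr0 !mulr1 !addr0 !add0r.
by rewrite mulrN1 scaleNr opprK.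
Qed.

Lemma pseudo_orthonormal_sym (R : realType) (V : vectType R)
    (g : {biscalar V}) (e1 e2 e3 : V) :
  pseudo_orthonormal_basis g e1 e2 e3 -> forall X Y, g X Y = g Y X.
Proof.
move=> ge X Y; have E := pseudo_orthonormal_expansion ge.
rewrite [X in LHS]E [Y in LHS]E [Y in RHS]E [X in RHS]E.
case: ge => be [g11 g22 g33] [g12 g13 g23] [g21 g31 g32].
rewrite !(linearBl, linearDl, linearBr, linearDr, linearZl_LR, linearZr_LR) /=.
by rewrite g11 g22 g33 g12 g13 g23 g21 g31 g32; ring.
Qed.

Lemma pseudo_orthonormal_inj (R : realType) (V : vectType R)
    (g : {biscalar V}) (e1 e2 e3 : V) :
  pseudo_orthonormal_basis g e1 e2 e3 ->
  forall X Y, (forall Z, g X Z = g Y Z) -> X = Y.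
Proof.
move=> /pseudo_orthonormal_expansion E X Y eqXY.
by rewrite [LHS]E [RHS]E !eqXY.
Qed.

Lemma pseudo_orthonormal_repr (R : realType) (V : vectType R)
    (g : {biscalar V}) (e1 e2 e3 : V) (f : V -> R) :
  pseudo_orthonormal_basis g e1 e2 e3 -> scalar f ->
  forall Z, g (f e1 *: e1 + f e2 *: e2 - f e3 *: e3) Z = f Z.
Proof.
move=> ge lf Z; have E := pseudo_orthonormal_expansion ge.
have f0 : f 0 = 0.
  by have := lf (-1) 0 0; rewrite scaler0 addr0 => ->; rewrite mulN1r addNr.
have fZ a X : f (a *: X) = a * f X by have := lf a X 0; rewrite addr0 f0 addr0.
have fD X Y : f (X + Y) = f X + f Y.
  by have := lf 1 X Y; rewrite scale1r mul1r.
have fN X : f (- X) = - f X by rewrite -scaleN1r fZ mulN1r.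
rewrite [in RHS](E Z) !(fD, fN, fZ) linearBl linearDl !linearZl_LR /=.
by rewrite !(pseudo_orthonormal_sym ge _ Z); ring.
Qed.

Lemma levi_civita_koszul (R : realType) (V : vectType R)
    (br : {bilinear V -> V -> V}) (g : {biscalar V}) (nabla : V -> V -> V) :
  (forall X, br X X = 0) -> (forall X Y, g X Y = g Y X) ->
  levi_civita br g nabla -> forall X Y Z,
  g (nabla X Y) Z = 2^-1 * (g (br X Y) Z - g (br Y Z) X + g (br Z X) Y).
Proof.
move=> brXX gC [tor met] X Y Z.
have m1 := met X Y Z; have m2 := met Y Z X; have m3 := met Z X Y.
rewrite (gC Y) in m1; rewrite (gC Z) in m2; rewrite (gC X) in m3.
by rewrite -!tor !linearBl /=; lra.
Qed.

Lemma levi_civita_unique (R : realType) (V : vectType R)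
    (br : {bilinear V -> V -> V}) (g : {biscalar V}) (e1 e2 e3 : V)
    (nabla nabla' : V -> V -> V) :
  (forall X, br X X = 0) -> pseudo_orthonormal_basis g e1 e2 e3 ->
  levi_civita br g nabla -> levi_civita br g nabla' ->
  forall X Y, nabla X Y = nabla' X Y.
Proof.
move=> brXX ge lc lc' X Y; have gC := pseudo_orthonormal_sym ge.
by apply: (pseudo_orthonormal_inj ge) => Z; rewrite (levi_civita_koszul brXX gC lc) (levi_civita_koszul brXX gC lc').
Qed.

Lemma levi_civita_exists (R : realType) (V : vectType R)
    (br : {bilinear V -> V -> V}) (g : {biscalar V}) (e1 e2 e3 : V) :
  (forall X, br X X = 0) -> pseudo_orthonormal_basis g e1 e2 e3 ->
  exists nabla : {bilinear V -> V -> V}, levi_civita br g nabla.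
Proof.
move=> brXX ge; have gC := pseudo_orthonormal_sym ge.
have brC X Y : br X Y = - br Y X.
  have := brXX (X + Y); rewrite linearDl !linearDr /= !brXX add0r addr0.
  by move/eqP; rewrite addr_eq0 => /eqP.
pose K X Y Z : R := 2^-1 * (g (br X Y) Z - g (br Y Z) X + g (br Z X) Y).
pose N X Y : V := K X Y e1 *: e1 + K X Y e2 *: e2 - K X Y e3 *: e3.
have NE X Y Z : g (N X Y) Z = K X Y Z.
  apply: (pseudo_orthonormal_repr ge) => a U W.
  rewrite /K !(linearPl, linearPr) /= ?(linearPl, linearPr) /=.
  by ring.
have Nbil : bilinear_for *:%R *:%R N.
  split=> X a Y Z; apply: (pseudo_orthonormal_inj ge) => W.
    rewrite /= linearPl /= !NE /K.
    by rewrite !(linearDl, linearDr, linearZl_LR, linearZr_LR) /=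
               ?(linearDl, linearZl_LR) /=; ring.
  rewrite /= linearPl /= !NE /K.
  by rewrite !(linearDl, linearDr, linearZl_LR, linearZr_LR) /=
             ?(linearDl, linearZl_LR) /=; ring.
pose NB := HB.pack_for {bilinear V -> V -> V} N
  (bilinear_isBilinear.Build R V V V *:%R *:%R N Nbil).
exists NB; split=> [X Y|X Y Z] /=.
  apply: (pseudo_orthonormal_inj ge) => Z; rewrite linearBl /= !NE /K.
  by rewrite (brC Y X) (brC X Z) (brC Z Y) !linearNl /=; lra.
rewrite (gC Y) !NE /K (brC Y X) (brC X Z) (brC Z Y) !linearNl /=; lra.
Qed.

Lemma kobayashi_nomizu_bilinear (R : realType) (V : vectType R)
    (nabla : {bilinear V -> V -> V}) (J : 'End(V)) (g : {biscalar V})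
    (e1 e2 e3 : V) :
  pseudo_orthonormal_basis g e1 e2 e3 ->
  exists nabla1 : {bilinear V -> V -> V},
    (nabla1 : V -> V -> V) = kobayashi_nomizu_connection nabla J.
Proof.
move=> ge; set nabla1 := kobayashi_nomizu_connection nabla J.
have fE (f : {bilinear V -> V -> V}) a X Y Z :
    f (a *: X + Y) Z = a *: f X Z + f Y Z /\
    f Z (a *: X + Y) = a *: f Z X + f Z Y.
  by rewrite linearPl linearPr.
have gE := (linearDl g, linearBl g, linearNl g, linearZl_LR g).
have N1bil : bilinear_for *:%R *:%R nabla1.
  split=> Z a X Y; apply: (pseudo_orthonormal_inj ge) => W;
  rewrite /= /nabla1 /kobayashi_nomizu_connection /canonical_connection;
  rewrite /covderiv_J ?linearP ?(proj1 (fE _ _ _ _ _)) ?(proj2 (fE _ _ _ _ _));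
  rewrite ?linearP ?(proj1 (fE _ _ _ _ _)) ?(proj2 (fE _ _ _ _ _));
  by rewrite !gE /= ?gE /=; ring.
by exists (HB.pack_for {bilinear V -> V -> V} nabla1
  (bilinear_isBilinear.Build R V V V *:%R *:%R nabla1 N1bil)).
Qed.

Lemma ricci_operator_exists (R : realType) (V : vectType R)
    (br nabla : {bilinear V -> V -> V}) (g : {biscalar V}) (e1 e2 e3 : V) :
  pseudo_orthonormal_basis g e1 e2 e3 ->
  exists Ric : 'End(V),
    ricci_operator (ricci_tensor br g e1 e2 e3 nabla) g Ric.
Proof.
move=> ge; pose rho := ricci_tensor br g e1 e2 e3 nabla.
have gE := (linearDl g, linearBl g, linearNl g, linearZl_LR g).
have rhol Y : scalar (rho^~ Y).
  move=> a X Z; rewrite /rho /ricci_tensor /curvature.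
  rewrite !linearPl /= ?linearPl ?linearPr /= ?linearPl /= !gE /= ?gE /=; ring.
have rhor X : scalar (rho X).
  move=> a Y Z; rewrite /rho /ricci_tensor /curvature.
  rewrite !linearPr /= ?linearPr /= !gE /= ?gE /=; ring.
pose Ric X : V := rho X e1 *: e1 + rho X e2 *: e2 - rho X e3 *: e3.
have RicE X Y : g (Ric X) Y = rho X Y.
  exact: (pseudo_orthonormal_repr ge (rhor X)).
have Riclin : linear Ric.
  move=> a X Y; apply: (pseudo_orthonormal_inj ge) => Z.
  by rewrite linearPl !RicE rhol.
pose RicL := HB.pack_for {linear V -> V} Ric
  (GRing.isLinear.Build R V V *:%R Ric Riclin).
by exists (linfun RicL) => X Y; rewrite lfunE /= RicE.
Qed.

Lemma ricci_operator_unique (R : realType) (V : vectType R) (g : {biscalar V})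
    (e1 e2 e3 : V) (rho : V -> V -> R) (Ric Ric' : 'End(V)) :
  pseudo_orthonormal_basis g e1 e2 e3 ->
  ricci_operator rho g Ric -> ricci_operator rho g Ric' -> Ric = Ric'.
Proof.
move=> ge RicE RicE'; apply/lfunP => X; apply: (pseudo_orthonormal_inj ge) => Y.
by rewrite -RicE -RicE'.
Qed.

(* Main.v *)
(** The Koszul formula gives nabla, hence nabla^1, on the basis, and
    Ric^1 e1 = -(beta^2 + gamma^2) e1, Ric^1 e3 = 0,
    Ric^1 e2 = -(gamma^2 + alpha beta) e2 + alpha gamma e3.
    The only candidate for D is Ric^1 - c Id, and it is a derivation iff the
    Leibniz rule holds on the pairs (e1,e2), (e1,e3), (e2,e3); this is a system
    of polynomial equations in alpha, beta, gamma, c.  Subtracting two of them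
    gives gamma^2 (alpha - beta) = alpha beta^2.  If beta <> 0, then
    alpha <> 0, and the remaining equations force c = 0 and alpha = beta,
    whence alpha beta^2 = 0, which is absurd. *)
Require Import Defs.
From HB Require Import structures.
From mathcomp Require Import all_boot all_order all_algebra.
From mathcomp Require Import reals.
From mathcomp Require Import ring lra.
Set Implicit Arguments.
Unset Strict Implicit.
Unset Printing Implicit Defensive.
Import Order.TTheory GRing.Theory Num.Theory.
Local Open Scope ring_scope.

(** * Reduction of the Leibniz rule to basis vectors *)

Lemma lie_bracket_skew (R : realType) (V : vectType R)
    (br : {bilinear V -> V -> V}) :
  lie_bracket br -> forall X Y, br X Y = - br Y X.
Proof.
case=> brXX _ X Y; have := brXX (X + Y).
rewrite linearDl !linearDr /= !brXX add0r addr0.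
by move/eqP; rewrite addr_eq0 => /eqP.
Qed.

Lemma pseudo_orthonormal_ind (R : realType) (V : vectType R)
    (g : {biscalar V}) (e1 e2 e3 : V) (P : V -> Prop) :
  pseudo_orthonormal_basis g e1 e2 e3 ->
  (forall a X Y, P X -> P Y -> P (a *: X + Y)) ->
  P e1 -> P e2 -> P e3 -> forall X, P X.
Proof.
move=> ge PD P1 P2 P3 X.
have P0 : P 0 by rewrite -(addNr e1) -scaleN1r; exact: PD.
(* The trailing zero puts the expansion in the nested form [a *: X + Y], ending in [P 0]. *)
rewrite (pseudo_orthonormal_expansion ge X) -addrA -scaleNr -[_ *: e3]addr0.
by do 3!apply: (PD) => //.
Qed.

(** The defect [D (br X Y) - br (D X) Y - br X (D Y)] is bilinear and alternating in [X], [Y], so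
    three pairs determine it. *)
Lemma derivation_basis (R : realType) (V : vectType R)
    (br : {bilinear V -> V -> V}) (g : {biscalar V}) (e1 e2 e3 : V)
    (D : 'End(V)) :
  lie_bracket br -> pseudo_orthonormal_basis g e1 e2 e3 ->
  D (br e1 e2) = br (D e1) e2 + br e1 (D e2) ->
  D (br e1 e3) = br (D e1) e3 + br e1 (D e3) ->
  D (br e2 e3) = br (D e2) e3 + br e2 (D e3) ->
  derivation br D.
Proof.
move=> br_lie ge D12 D13 D23; have brC := lie_bracket_skew br_lie.
pose P X Y := D (br X Y) = br (D X) Y + br X (D Y).
have PC X Y : P X Y -> P Y X.
  rewrite /P => PXY; rewrite (brC Y X) linearN /= PXY opprD addrC.
  by rewrite (brC (D Y)) (brC Y).
have Pdiag X : P X X.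
  by rewrite /P (br_lie.1 X) linear0 (brC X) subrr.
have PD Z a X Y : P X Z -> P Y Z -> P (a *: X + Y) Z.
  rewrite /P => PX PY; rewrite linearPl !linearP /= linearPl linearPl PX PY.
  by rewrite scalerDr addrACA.
have Pe Z : P e1 Z -> P e2 Z -> P e3 Z -> forall X, P X Z.
  by move=> P1 P2 P3; apply: (pseudo_orthonormal_ind ge) => // a X Y; exact: PD.
by move=> X Y; apply: (Pe); apply: (PC); apply: (Pe) => //; apply: (PC).
Qed.

(** * Connections and Ricci operator in the frame *)

Section G2.
Variables (R : realType) (alpha beta gamma : R) (V : vectType R).
Variables (br : {bilinear V -> V -> V}) (g : {biscalar V}) (J : 'End(V)).
Variables (e1 e2 e3 : V).
Hypothesis br_lie : lie_bracket br.
Hypothesis e_basis : pseudo_orthonormal_basis g e1 e2 e3.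
Hypothesis br12 : br e1 e2 = gamma *: e2 - beta *: e3.
Hypothesis br13 : br e1 e3 = - beta *: e2 - gamma *: e3.
Hypothesis br23 : br e2 e3 = alpha *: e1.
Hypotheses (J1 : J e1 = e1) (J2 : J e2 = e2) (J3 : J e3 = - e3).
Variable nabla : {bilinear V -> V -> V}.
Hypothesis nabla_LC : levi_civita br g nabla.

Let gE := (linear0l g, linearDl g, linearBl g, linearNl g, linearZl_LR g).

Lemma br_basis :
  (br e1 e1 = 0) * (br e2 e2 = 0) * (br e3 e3 = 0) *
  (br e2 e1 = - (gamma *: e2 - beta *: e3)) *
  (br e3 e1 = - (- beta *: e2 - gamma *: e3)) *
  (br e3 e2 = - (alpha *: e1)).
Proof.
have brC := lie_bracket_skew br_lie; do !split; rewrite ?br_lie.1 //.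
- by rewrite brC br12.
- by rewrite brC br13.
- by rewrite brC br23.
Qed.

Lemma g_basis :
  (g e1 e1 = 1) * (g e2 e2 = 1) * (g e3 e3 = -1) *
  (g e1 e2 = 0) * (g e1 e3 = 0) * (g e2 e3 = 0) *
  (g e2 e1 = 0) * (g e3 e1 = 0) * (g e3 e2 = 0).
Proof. by case: e_basis => _ [-> -> ->] [-> -> ->] [-> -> ->]. Qed.

(** Turns each vector identity below into three scalar ones, within reach of [ring] and [field]. *)
Lemma eq_frame (X Y : V) :
  g X e1 = g Y e1 -> g X e2 = g Y e2 -> g X e3 = g Y e3 -> X = Y.
Proof.
have E := pseudo_orthonormal_expansion e_basis.
by move=> h1 h2 h3; rewrite (E X) (E Y) h1 h2 h3.
Qed.

Lemma levi_civita_G2 :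
  ((nabla e1 e1 = 0) *
   (nabla e1 e2 = (2^-1 * alpha - beta) *: e3) *
   (nabla e1 e3 = (2^-1 * alpha - beta) *: e2)) *
  ((nabla e2 e1 = - gamma *: e2 + (2^-1 * alpha) *: e3) *
   (nabla e2 e2 = gamma *: e1) *
   (nabla e2 e3 = (2^-1 * alpha) *: e1)) *
  ((nabla e3 e1 = (2^-1 * alpha) *: e2 + gamma *: e3) *
   (nabla e3 e2 = - (2^-1 * alpha) *: e1) *
   (nabla e3 e3 = gamma *: e1)).
Proof.
have K := levi_civita_koszul br_lie.1 (pseudo_orthonormal_sym e_basis) nabla_LC.
do !split; apply: eq_frame;
  rewrite K !(br_basis, br12, br13, br23) ?gE /= ?gE /= ?g_basis;
  by field.
Qed.

(** As a check, the table shows that every [N X] preserves both eigenspaces of [J], the span of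
    [e1], [e2] and the line of [e3]. *)
Lemma kobayashi_nomizu_G2 (N := kobayashi_nomizu_connection nabla J) :
  ((N e1 e1 = 0) * (N e1 e2 = 0) * (N e1 e3 = - gamma *: e3)) *
  ((N e2 e1 = - gamma *: e2) * (N e2 e2 = gamma *: e1) * (N e2 e3 = 0)) *
  ((N e3 e1 = beta *: e2) * (N e3 e2 = - alpha *: e1) * (N e3 e3 = 0)).
Proof.
rewrite /N /kobayashi_nomizu_connection /canonical_connection /covderiv_J.
have JN3 : J (- e3) = e3 by rewrite linearN /= J3 opprK.
do !split; apply: eq_frame.
all: rewrite !(J1, J2, J3, JN3) /=.
all: rewrite !(linearNl nabla, linearNr nabla, levi_civita_G2).
all: rewrite !(linearN J, linearD J, linearB J, linearZ_LR J, linear0 J) /=.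
all: rewrite ?(J1, J2, J3).
all: rewrite ?gE /= ?gE /= ?g_basis.
all: by field.
Qed.

Variable Ric1 : 'End(V).
Hypothesis Ric1_def : ricci_operator
  (ricci_tensor br g e1 e2 e3 (kobayashi_nomizu_connection nabla J)) g Ric1.

Lemma ricci_G2 :
  (Ric1 e1 = - (beta ^+ 2 + gamma ^+ 2) *: e1) *
  (Ric1 e2 = - (gamma ^+ 2 + alpha * beta) *: e2 + (alpha * gamma) *: e3) *
  (Ric1 e3 = 0).
Proof.
(* Trades the plain function for a bundled bilinear map, so that the linearity lemmas can expand the
   curvature. *)
have [N NE] := kobayashi_nomizu_bilinear nabla J e_basis.
have NG := kobayashi_nomizu_G2; have RicE := Ric1_def; rewrite -NE in NG RicE.
do !split; apply: eq_frame; rewrite -RicE /ricci_tensor /curvature.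
all: rewrite !(NG, br_basis, br12, br13, br23).
all: rewrite !(linearBl N, linearDl N, linearNl N, linearZl_LR N, linear0l N,
  linearBr N, linearDr N, linearNr N, linearZr_LR N, linear0r N) /=.
all: rewrite !NG ?gE /= ?gE /= ?g_basis.
all: ring.
Qed.

(** * The soliton condition as a polynomial system *)

Variable c : R.

Lemma soliton_derivation_G2 (D : 'End(V)) :
  Ric1 = c *: \1%VF + D ->
  (D e1 = - (beta ^+ 2 + gamma ^+ 2 + c) *: e1) *
  (D e2 = - (gamma ^+ 2 + alpha * beta + c) *: e2 + (alpha * gamma) *: e3) *
  (D e3 = - c *: e3).
Proof.
move=> RicD; have DE X : D X = Ric1 X - c *: X.
  by rewrite RicD add_lfunE scale_lfunE id_lfunE addrC addKr.
do !split; rewrite DE ricci_G2; apply: eq_frame; rewrite ?gE /= ?gE /=; ring.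
Qed.

(** In order: the [e2] and [e3] components of the Leibniz rule on (e1,e2), the [e2] component on
    (e1,e3), the [e1] component on (e2,e3). The [e3] component on (e1,e3) repeats the first
    equation; the others are trivial. *)
Lemma soliton_equations_G2 (D : 'End(V)) :
  soliton_decomposition br Ric1 c D ->
  [/\ gamma * (gamma ^+ 2 + alpha * beta + beta ^+ 2 + c) = 0,
      2 * alpha * gamma ^+ 2 - beta * (c + 2 * gamma ^+ 2 + beta ^+ 2
        + alpha * beta) = 0,
      beta * (alpha * beta - c - beta ^+ 2) = 0 &
      alpha * (alpha * beta + c - beta ^+ 2) = 0].
Proof.
case=> derD /soliton_derivation_G2 DE.
have D12 := derD e1 e2; have D13 := derD e1 e3; have D23 := derD e2 e3.
move: D12 D13 D23.
rewrite br12 br13 br23 !(linearB D, linearD D, linearN D, linearZ_LR D) /= !DE.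
rewrite !(linearZl_LR br, linearZr_LR br, linearDl br, linearDr br) /=.
rewrite !(br_basis, br12, br13, br23).
move=> D12 D13 D23; split.
- have := congr1 (g^~ e2) D12; rewrite /= ?gE /= ?gE /= ?g_basis => E; lra.
- have := congr1 (g^~ e3) D12; rewrite /= ?gE /= ?gE /= ?g_basis => E; lra.
- have := congr1 (g^~ e2) D13; rewrite /= ?gE /= ?gE /= ?g_basis => E; lra.
- have := congr1 (g^~ e1) D23; rewrite /= ?gE /= ?gE /= ?g_basis => E; lra.
Qed.

End G2.

Lemma soliton_equations_solution (R : realFieldType) (alpha beta gamma c : R) :
  gamma != 0 ->
  gamma * (gamma ^+ 2 + alpha * beta + beta ^+ 2 + c) = 0 ->
  2 * alpha * gamma ^+ 2 - beta * (c + 2 * gamma ^+ 2 + beta ^+ 2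
    + alpha * beta) = 0 ->
  beta * (alpha * beta - c - beta ^+ 2) = 0 ->
  alpha * (alpha * beta + c - beta ^+ 2) = 0 ->
  [/\ alpha = 0, beta = 0 & gamma ^+ 2 + c = 0].
Proof.
move=> g0 /eqP; rewrite mulf_eq0 (negPf g0) => /eqP E1 E2 E3 E4.
(* Half of [E2] minus [E3]: the terms in [beta * c] and [beta ^+ 3] cancel. *)
have gE : gamma ^+ 2 * (alpha - beta) = alpha * beta ^+ 2 by lra.
have g20 : gamma ^+ 2 != 0 by rewrite sqrf_eq0.
have b0 : beta = 0.
  apply/eqP; apply: contraT => b0.
  have a0 : alpha != 0.
    apply: contraNneq b0 => a0; move: gE; rewrite a0 mul0r sub0r => /eqP.
    by rewrite mulf_eq0 (negPf g20) oppr_eq0.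
  move/eqP: E3; rewrite mulf_eq0 (negPf b0) => /eqP E3.
  move/eqP: E4; rewrite mulf_eq0 (negPf a0) => /eqP E4.
  (* Adding the reduced [E3] and [E4] eliminates [c]. *)
  have : beta * (alpha - beta) = 0 by lra.
  move/eqP; rewrite mulf_eq0 (negPf b0) => /eqP ab.
  move: gE; rewrite ab mulr0 => /esym/eqP.
  by rewrite mulf_eq0 (negPf a0) sqrf_eq0 (negPf b0).
have a0 : alpha = 0.
  move: gE; rewrite b0 subr0 expr0n /= mulr0 => /eqP.
  by rewrite mulf_eq0 (negPf g20) => /eqP.
by split=> //; move: E1; rewrite b0 a0 => E1; lra.
Qed.

Theorem theorem2p20 (R : realType) (alpha beta gamma c : R)
    (gamma_neq0 : gamma != 0)
    (V : vectType R) (br : {bilinear V -> V -> V}) (g : {biscalar V})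
    (J : 'End(V)) (e1 e2 e3 : V)
    (br_lie : lie_bracket br)
    (e_basis : pseudo_orthonormal_basis g e1 e2 e3)
    (br12 : br e1 e2 = gamma *: e2 - beta *: e3)
    (br13 : br e1 e3 = - beta *: e2 - gamma *: e3)
    (br23 : br e2 e3 = alpha *: e1)
    (J1 : J e1 = e1) (J2 : J e2 = e2) (J3 : J e3 = - e3)
    (nabla : {bilinear V -> V -> V})
    (nabla_LC : levi_civita br g nabla)
    (Ric1 : 'End(V))
    (Ric1_def : ricci_operator
       (ricci_tensor br g e1 e2 e3 (kobayashi_nomizu_connection nabla J))
       g Ric1) :
  (algebraic_ricci_soliton br Ric1 c <->
     [/\ alpha = 0, beta = 0, gamma ^+ 2 + c = 0 & gamma != 0]) /\
  (algebraic_ricci_soliton br Ric1 c ->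
     [/\ Ric1 e1 = - gamma ^+ 2 *: e1,
         Ric1 e2 = - gamma ^+ 2 *: e2 &
         Ric1 e3 = 0] /\
     (forall D : 'End(V), soliton_decomposition br Ric1 c D ->
        [/\ D e1 = 0, D e2 = 0 & D e3 = gamma ^+ 2 *: e3])).
Proof.
have RicE := ricci_G2 br_lie e_basis br12 br13 br23 J1 J2 J3 nabla_LC Ric1_def.
have DE := soliton_derivation_G2 br_lie e_basis br12 br13 br23 J1 J2 J3
  nabla_LC Ric1_def.
have solE : algebraic_ricci_soliton br Ric1 c ->
    [/\ alpha = 0, beta = 0 & gamma ^+ 2 + c = 0].
  case=> D /(soliton_equations_G2 br_lie e_basis br12 br13 br23 J1 J2 J3
    nabla_LC Ric1_def) [E1 E2 E3 E4].
  exact: (soliton_equations_solution gamma_neq0 E1 E2 E3 E4).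
split; [split |] => [/solE [a0 b0 gc] | [a0 b0 gc _] | /solE [a0 b0 gc]].
- by [].
- pose D := Ric1 - c *: \1%VF.
  have RicD : Ric1 = c *: \1%VF + D by rewrite addrC subrK.
  exists D; split=> //; have {}DE := DE _ _ RicD; clearbody D.
  rewrite a0 b0 expr0n /= !mul0r add0r addr0 gc oppr0 !scale0r addr0 in DE.
  (* Now [D] is diagonal with eigenvalues 0, 0, [- c], while [br e1 e2 = gamma *: e2],
     [br e1 e3 = - gamma *: e3] and [br e2 e3 = 0]: eigenvalues add up along each nonzero
     bracket. *)
  apply: (derivation_basis br_lie e_basis);
    rewrite !DE (linear0l br) ?(linear0r br) ?(linearZr_LR br) /= add0r.
  + by rewrite br12 b0 scale0r subr0 (linearZ_LR D) /= DE scaler0.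
  + rewrite br13 b0 oppr0 scale0r sub0r (linearN D) (linearZ_LR D) /= DE.
    by rewrite scalerN !scalerA mulrC.
  + by rewrite br23 a0 !scale0r scaler0 (linear0 D).
- split=> [|D [_ /DE {}DE]]; rewrite !(RicE, DE) a0 b0 expr0n /=.
  + by rewrite add0r !mul0r addr0 scale0r addr0.
  + rewrite add0r mul0r addr0 gc oppr0 !scale0r mul0r scale0r addr0.
    by split=> //; congr (_ *: _); lra.
Qed.
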